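(* Let $\mu>3/2$. Then for all $r>0$, $$S_\mu(r)\ \ge\ \frac{2\mu-1}{2\mu\, r^3}\,S_{\mu-1}(r)-\frac{(2\mu-1)\sqrt{\pi}\,\Gamma(2\mu)\,\zeta(2\mu-1)}{2^{2\mu-2}\,r^3\,\Gamma(\mu+1)\,\Gamma(\mu+1/2)}.$$
   Context: For $\mu>0$ and $r>0$, the generalized Mathieu series is $S_\mu(r)=\sum_{n=1}^\infty \frac{2n}{(n^2+r^2)^{\mu+1}}$. $\Gamma$ is the Gamma function and $\zeta$ is the Riemann zeta function. *)

(* Defs.v *)
From HB Require Import structures.
From mathcomp Require Import all_boot all_order all_algebra.
From mathcomp Require Import all_classical all_reals all_analysis.

Set Implicit Arguments.
Unset Strict Implicit.
Unset Printing Implicit Defensive.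

Import Order.TTheory GRing.Theory Num.Theory.
Import numFieldNormedType.Exports.

Local Open Scope classical_set_scope.
Local Open Scope ring_scope.

(* The usual series over n >= 1, reindexed by n.+1; it converges for 0 < mu. *)
Definition mathieu {R : realType} (mu r : R) : R :=
  limn [series 2 * n.+1%:R / (n.+1%:R ^+ 2 + r ^+ 2) `^ (mu + 1)]_n.

(* Euler's integral; it is the Gamma function only for 0 < x. *)
Definition Gamma {R : realType} (x : R) : R :=
  \int[lebesgue_measure]_(t in `]0, +oo[) (t `^ (x - 1) * expR (- t)).

(* The Dirichlet series; it is the Riemann zeta function only for 1 < s. *)
Definition zeta {R : realType} (s : R) : R :=
  limn [series (n.+1%:R `^ s)^-1]_n.

(* Main.v *)
(* The right-hand side is negative. Termwise, S_(mu-1)(r) <= 2 zeta(2 mu - 1),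
   whereas by Legendre's duplication formula the subtracted term is
   2 (2 mu - 1) zeta(2 mu - 1) / (mu r^3), twice what is needed. So Legendre's
   formula is only required as an inequality up to a factor 2,
     Gamma(a) Gamma(a + 1/2) <= 4 sqrt(pi) 2^(-2a) Gamma(2a),
   together with Gamma(a + 1) <= a Gamma(a). In the double integral of
   s^(a-1/2) t^(a-1) e^(-s-t), put v = sqrt(s t) for fixed s and exchange the
   integrals; then y = sqrt s - v / sqrt s satisfies
   s + v^2 / s = 2 v + y^2 and s^(-1/2) ds <= 2 dy, so the s-integral is at most
   a Gaussian one.
   All changes of variables are needed only as inequalities, which avoids any
   surjectivity or endpoint hypothesis. *)
Require Import Defs.
From HB Require Import structures.
From mathcomp Require Import all_boot all_order all_algebra.
From mathcomp Require Import all_classical all_reals all_analysis.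
(* [all_analysis] alone does not leave the measurable structure of [\bar R]
   available; importing [measurable_realfun] again restores it. *)
From mathcomp Require Import measurable_realfun.
From mathcomp Require Import ring lra.
Import Order.TTheory GRing.Theory Num.Theory.
Import numFieldNormedType.Exports.
Local Open Scope ring_scope.

Local Notation leb := lebesgue_measure.

(** * Improper integrals over the half-line and substitution as an inequality *)

(** Monotone convergence along an increasing sequence of compact intervals that exhausts the
    half-line. *)
Lemma ge0_integral_oy_le {R : realType} (f : R -> R) (C : \bar R) :
  measurable_fun (`]0, +oo[%classic : set R) f -> (forall x : R, 0 < x -> 0 <= f x) ->
  (forall a b : R, 0 < a -> a < b -> (\int[leb]_(x in `[a, b]) (f x)%:E <= C)%E) ->
  (\int[leb]_(x in `]0%R, +oo[) (f x)%:E <= C)%E.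
Proof.
move=> mf f0 fC.
(* [n.+2] keeps the end points distinct already at n = 0, as the strict a < b in [fC] demands. *)
pose I (n : nat) : set R := `[n.+2%:R^-1, n.+2%:R]%classic.
have Isub n : (I n `<=` `]0%R, +oo[)%classic.
  move=> x; rewrite /I /= !in_itv /= andbT => /andP[+ _].
  by apply: lt_le_trans; rewrite invr_gt0.
have -> : `]0%R, +oo[%classic = (\bigcup_n I n)%classic.
  apply/seteqP; split => [x|x [n _ /Isub]//].
  rewrite /= in_itv /= andbT => x0.
  (* Both x and 1/x are at most x + 1/x, so one n serves both ends. *)
  have [n _ nx] : exists2 n, True & x + x^-1 <= n.+2%:R.
    exists (Num.truncn (x + x^-1)) => //.
    rewrite (le_trans (ltW (truncnS_gt _)))// ler_nat//.
  exists n => //; rewrite /I /= in_itv /=.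
  have xi : 0 < x^-1 by rewrite invr_gt0.
  apply/andP; split; last by lra.
  by rewrite -[leRHS]invrK lef_pV2 ?posrE//; lra.
have mI n : measurable_fun (I n) (EFin \o f).
  apply/measurable_EFinP.
  by apply: measurable_funS mf => //; exact: Isub.
have I_nd : {homo I : n m / (n <= m)%N >-> (n <= m)%O}.
  move=> n m nm; apply/subsetPset => x; rewrite /I /= !in_itv /= => /andP[h1 h2].
  apply/andP; split.
    by apply: le_trans h1; rewrite lef_pV2 ?posrE// ler_nat.
  by apply: le_trans h2 _; rewrite ler_nat.
have f0I n x : I n x -> (0 <= (f x)%:E)%E.
  move=> /Isub; rewrite /= in_itv /= andbT lee_fin; exact: f0.
have cvgI := ge0_nondecreasing_set_cvg_integral (mu := leb)
  I_nd (fun n => measurable_itv _) mI f0I.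
rewrite -(cvg_lim _ cvgI)//; apply: lime_le; first by apply/cvg_ex; eexists; exact: cvgI.
apply: nearW => n; apply: fC; first by rewrite invr_gt0.
by rewrite (@lt_trans _ _ 1)// ?invf_lt1 ?ltr1n.
Qed.

(** On [a, b] the usual substitution gives the integral of G over [F a, F b]. This lies in D because
    D is an interval containing both ends, and G >= 0 there, so enlarging the domain to D can only
    increase the integral. *)
Lemma ge0_substitution_oy_le {R : realType} (F f G : R -> R) (D : set R) :
  (forall x : R, 0 < x -> is_derive x 1 F (f x)) ->
  (forall x : R, 0 < x -> 0 < f x) ->
  (forall x : R, 0 < x -> {for x, continuous f}) ->
  open D -> is_interval D -> (forall x : R, 0 < x -> D (F x)) ->
  (forall y, D y -> {for y, continuous G}) -> (forall y, D y -> 0 <= G y) ->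
  (\int[leb]_(x in `]0%R, +oo[) (G (F x) * f x)%:E <=
   \int[leb]_(y in D) (G y)%:E)%E.
Proof.
move=> dF f0 cf oD iD FD cG G0.
have cF x : 0 < x -> {for x, continuous F}.
  move=> x0; apply/differentiable_continuous/derivable1_diffP.
  by apply: ex_derive; exact: dF.
have cGFf x : 0 < x -> {for x, continuous (fun x => G (F x) * f x)}.
  move=> x0; apply: cvgM; last exact: cf.
  by apply: continuous_comp; [exact: cF | exact/cG/FD].
have F'E x : 0 < x -> F^`()%classic x = f x.
  by move=> x0; rewrite derive1E; have [_ ->] := dF _ x0.
have cF' x : 0 < x -> {for x, continuous F^`()%classic}.
  move=> x0; rewrite /prop_for /continuous_at F'E//.
  apply: cvg_trans (cf _ x0); apply: near_eq_cvg; near=> z.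
  by rewrite F'E//; near: z; exact: lt_nbhsr.
have Finc a b : 0 < a -> a < b -> F a < F b.
  move=> a0 ab; apply: (@gtr0_derive1_lt_cc _ F a b) => //.
  - move=> x; rewrite in_itv /= => /andP[ax _].
    by apply: ex_derive; apply: dF; exact: lt_trans ax.
  - move=> x; rewrite in_itv /= => /andP[ax _].
    by rewrite F'E ?f0// (lt_trans a0).
  - apply: continuous_in_subspaceT => y; rewrite inE /= in_itv /= => /andP[ay _].
    by apply: cF; exact: lt_le_trans ay.
  - by rewrite in_itv /= lexx ltW.
  - by rewrite in_itv /= lexx ltW.
apply: ge0_integral_oy_le.
- apply: open_continuous_measurable_fun => // x.
  by rewrite inE /= in_itv /= andbT; exact: cGFf.
- move=> x x0; apply: mulr_ge0; [exact/G0/FD | exact/ltW/f0].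
move=> a b a0 ab.
have -> : (\int[leb]_(x in `[a, b]) (G (F x) * f x)%:E =
   \int[leb]_(x in `[a, b]) (((G \o F) * F^`()%classic) x)%:E)%E.
  apply: eq_integral => x; rewrite inE /= in_itv /= => /andP[ax _].
  by rewrite !fctE F'E// (lt_le_trans a0).
have sub : (`[F a, F b] `<=` D)%classic.
  move=> y; rewrite /= in_itv /= => yab.
  by apply: (iD (F a) (F b)) yab; apply: FD => //; exact: lt_trans ab.
rewrite -integration_by_substitution_increasing.
- apply: ge0_subset_integral => //=.
  + exact: open_measurable.
  + apply/measurable_EFinP; apply: open_continuous_measurable_fun => // y.
    by rewrite inE; exact: cG.
- exact: ltW.
- move=> x y; rewrite !in_itv /= => /andP[ax _] _; apply: Finc.
  exact: lt_le_trans ax.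
- move=> x; rewrite in_itv /= => /andP[ax _]; apply: cF'; exact: lt_trans ax.
- apply/cvg_ex; exists (F^`()%classic a); apply: cvg_at_right_filter.
  exact: cF'.
- apply/cvg_ex; exists (F^`()%classic b); apply: cvg_at_left_filter.
  by apply: cF'; exact: lt_trans ab.
- split.
  + move=> x; rewrite in_itv /= => /andP[ax _].
    by apply: ex_derive; apply: dF; exact: lt_trans ax.
  + by apply: cvg_at_right_filter; exact: cF.
  + by apply: cvg_at_left_filter; apply: cF; exact: lt_trans ab.
- apply: continuous_in_subspaceT => y; rewrite inE => /sub; exact: cG.
Unshelve. all: end_near. Qed.

Lemma continuous_powR_pos {R : realType} (a x : R) : 0 < x ->
  {for x, continuous (@powR R ^~ a)}.
Proof.
move=> x0; apply/differentiable_continuous/derivable1_diffP.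
by apply: derivable_powR; rewrite in_itv /= x0.
Qed.

(** * Finiteness and positivity of the Gamma integral *)

Section Gamma_facts.
Context {R : realType}.
Implicit Types a p t : R.

(** The antiderivative -2 e^(-t/2) maps the half-line into ]-2, 0[. Substitution with G = 1
    therefore bounds the integral by the length of that interval. *)
Lemma integral_expRN_half :
  (\int[leb]_(t in `]0%R, +oo[) (expR (- (t / 2 : R)))%:E <= 2%:E)%E.
Proof.
have := @ge0_substitution_oy_le R (fun t => - 2 * expR (- (t / 2)))
  (fun t => expR (- (t / 2))) (cst 1) `]-2, 0[%classic.
have dE (x : R) : is_derive x 1 (fun t : R => - 2 * expR (- (t / 2))) (expR (- (x / 2))).
  by apply: is_derive_eq; rewrite /GRing.scale/=; field.
under eq_integral do rewrite mul1r.
move=> H; apply: le_trans (H _ _ _ _ _ _ _ _) _ => //.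
- by move=> x _; exact: expR_gt0.
- move=> x _; apply: continuous_comp; last exact: continuous_expR.
  by apply: continuousN; apply: continuousM; [exact: cvg_id|exact: cst_continuous].
- exact: interval_is_interval.
- move=> x x0; rewrite /= in_itv /=; have := expR_gt0 (- (x / 2)).
  have : expR (- (x / 2)) < 1 by rewrite -[ltRHS]expR0 ltr_expR; lra.
  by move=> *; apply/andP; split; lra.
- by move=> y _; exact: cst_continuous.
change (\int[leb]_(y in `](-2)%R, 0%R[) cst (1 : \bar R) y <= 2%:E)%E.
rewrite integral_cst// mul1e /= lebesgue_measure_itv /= lte_fin ifT; last by lra.
by rewrite -EFinB lee_fin; lra.
Qed.

Lemma measurable_Gamma_integrand p (D : set R) :
  measurable_fun D (fun t : R => t `^ p * expR (- t)).
Proof.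
apply: measurable_funTS; apply: measurable_funM; first exact: measurable_powR.
by apply: measurableT_comp; [exact: measurable_expR|exact: oppr_measurable].
Qed.

Lemma Gamma_integrand_ge0 p t : 0 <= t `^ p * expR (- t).
Proof. by rewrite mulr_ge0 ?powR_ge0 ?expR_ge0. Qed.

Lemma Gamma_integral_lty a : 1 < a ->
  (\int[leb]_(t in `]0%R, +oo[) (t `^ (a - 1) * expR (- t))%:E < +oo)%E.
Proof.
(* This is (2 (a - 1))^(a - 1), the maximum of t^(a-1) e^(-t/2) up to a factor e^(-(a-1)). *)
move=> a1; set c := expR ((a - 1) * ln (2 * (a - 1))).
(* From [ln y <= y] at [y = t / (2 (a - 1))]. *)
have bnd t : 0 < t -> t `^ (a - 1) * expR (- t) <= c * expR (- (t / 2)).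
  move=> t0; rewrite /powR gt_eqF// -!expRD ler_expR.
  have : ln (t / (2 * (a - 1))) <= t / (2 * (a - 1)).
    have y0 : 0 < t / (2 * (a - 1)) by rewrite divr_gt0//; lra.
    have := @le_ln1Dx R (t / (2 * (a - 1)) - 1); rewrite addrCA subrr addr0.
    by move=> H; apply: le_trans (H _) _; lra.
  rewrite lnM ?posrE ?invr_gt0; [|lra|lra].
  rewrite lnV ?posrE; last by lra.
  rewrite -(ler_pM2l (_ : 0 < a - 1)); last by lra.
  have -> : (a - 1) * (t / (2 * (a - 1))) = t / 2 by field; lra.
  by lra.
have mE : measurable_fun (`]0%R, +oo[%classic : set R) (fun t : R => expR (- (t / 2))).
  apply: measurable_funTS; apply: measurableT_comp; first exact: measurable_expR.
  by apply: measurableT_comp; [exact: oppr_measurable|apply: measurable_funM].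
apply: (@le_lt_trans _ _ (\int[leb]_(t in `]0%R, +oo[) (c * expR (- (t / 2)))%:E)%E).
  apply: ge0_le_integral => //.
  - by move=> t _; rewrite lee_fin Gamma_integrand_ge0.
  - by apply/measurable_EFinP; exact: measurable_Gamma_integrand.
  - by apply/measurable_EFinP; apply: measurable_funM.
  - by move=> t; rewrite /= in_itv /= andbT lee_fin; exact: bnd.
under eq_integral do rewrite EFinM.
rewrite ge0_integralZl_EFin ?expR_ge0//; last exact/measurable_EFinP.
rewrite lte_mul_pinfty// ?lee_fin ?expR_ge0//.
by apply: le_lt_trans integral_expRN_half _; rewrite ltry.
Qed.

(** [Gamma] is the [fine] of an extended integral, and [fine] sends +oo to 0. Finiteness is what
    ties the real number to the integral. *)
Lemma EFin_Gamma a : 1 < a ->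
  ((Gamma a)%:E = \int[leb]_(t in `]0%R, +oo[) (t `^ (a - 1) * expR (- t))%:E)%E.
Proof.
move=> a1; rewrite /Gamma /Rintegral fineK// ge0_fin_numE ?Gamma_integral_lty//.
by apply: integral_ge0 => t _; rewrite lee_fin Gamma_integrand_ge0.
Qed.

(** On [1, 2] the power is at least 1 and the exponential at least e^(-2). *)
Lemma Gamma_gt0 a : 1 < a -> 0 < Gamma a.
Proof.
move=> a1; rewrite -lte_fin EFin_Gamma//.
apply: (@lt_le_trans _ _ (\int[leb]_(t in `[1%R, 2%R]) (cst (expR (- 2 : R))%:E t))%E).
  rewrite integral_cst//= lebesgue_measure_itv /= lte_fin ifT; last by lra.
  by rewrite -EFinB -EFinM lte_fin mulr_gt0 ?expR_gt0//; lra.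
apply: (@le_trans _ _ (\int[leb]_(t in `[1%R, 2%R]) (t `^ (a - 1) * expR (- t))%:E)%E).
  apply: ge0_le_integral => //.
  - by move=> t _; rewrite lee_fin expR_ge0.
  - by apply/measurable_EFinP; exact: measurable_Gamma_integrand.
  - move=> t; rewrite /= in_itv /= => /andP[t1 t2]; rewrite lee_fin.
    rewrite -[leLHS]mul1r ler_pM ?expR_ge0//; last by rewrite ler_expR; lra.
    by rewrite -[leLHS](powRr0 t) ler_powR//; lra.
apply: ge0_subset_integral => //.
- by apply/measurable_EFinP; exact: measurable_Gamma_integrand.
- by move=> t _; rewrite lee_fin Gamma_integrand_ge0.
- by move=> t; rewrite /= !in_itv /= andbT => /andP[t1 _]; lra.
Qed.

End Gamma_facts.

(** * Comparison of the Mathieu series with zeta *)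

(** Dropping r^2 from the denominator leaves n / (n^2)^(m+1) = n^(-(2m+1)). *)
Lemma mathieu_term_le {R : realType} (m r : R) (n : nat) : 0 < m ->
  2 * n.+1%:R / (n.+1%:R ^+ 2 + r ^+ 2) `^ (m + 1) <=
  2 * (n.+1%:R `^ (2 * m + 1))^-1 :> R.
Proof.
move=> m0; rewrite -mulrA ler_pM2l//.
have n0 : 0 < n.+1%:R :> R by rewrite ltr0n.
have -> : (n.+1%:R `^ (2 * m + 1))^-1 = n.+1%:R / (n.+1%:R ^+ 2) `^ (m + 1) :> R.
  rewrite -powR_mulrn ?ltW// -powRrM.
  have -> : 2 * m + 1 = 2%:R * (m + 1) - 1 by ring.
  rewrite powRB ?powRr1 ?ltW// ?invf_div//.
  by rewrite (gt_eqF n0) implybT.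
rewrite ler_pM2l// lef_pV2 ?posrE ?powR_gt0//.
- by rewrite ge0_ler_powR ?nnegrE//; have := sqr_ge0 r; have := exprn_gt0 2 n0; lra.
- by have := sqr_ge0 r; have := exprn_gt0 2 n0; lra.
Qed.

Lemma cvg_zeta_series {R : realType} (s : R) : 2 <= s ->
  cvgn [series (n.+1%:R `^ s)^-1]_n.
Proof.
move=> s2.
have n0 n : 0 < n.+1%:R :> R by rewrite ltr0n.
have pos n : 0 <= (n.+1%:R `^ s)^-1 :> R by rewrite invr_ge0 powR_ge0.
apply: nondecreasing_is_cvgn.
  by apply: nondecreasing_series => k _ _; exact: pos.
(* The sum of the first n terms is at most 2 - 2/(n+1), by telescoping: 1/(n+1)^2 <= 2/(n+1) -
   2/(n+2), with gap n / ((n+1)^2 (n+2)). *)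
exists 2 => _ [n _ <-]; apply: (@le_trans _ _ (2 - 2 / n.+1%:R)); last first.
  by rewrite lerBlDr lerDl divr_ge0.
elim: n => [|n IH]; first by rewrite /series /= big_geq// divr1 subrr.
rewrite seriesSr; apply: le_trans (lerD IH (_ : _ <= (n.+1%:R ^+ 2)^-1)) _ => /=.
  rewrite lef_pV2 ?posrE ?powR_gt0 ?exprn_gt0//.
  by rewrite -[leLHS]powR_mulrn// ler_powR// ler1n.
rewrite -!natr1; have := ler0n R n; set x := n%:R => x0.
have h1 : 0 < x + 1 by lra.
have h2 : 0 < x + 1 + 1 by lra.
rewrite -subr_ge0 [leRHS](_ : _ = x / ((x + 1) ^+ 2 * (x + 1 + 1))); last first.
  by field; lra.
by rewrite divr_ge0// mulr_ge0 ?exprn_ge0//; lra.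
Qed.

Section mathieu_bounds.
Context {R : realType}.
Variables m r : R.
(** The zeta exponent 2m + 1 is then at least 2, the range of [cvg_zeta_series]. The values used are
    m = mu and m = mu - 1, with mu > 3/2. *)
Hypothesis m_half : 1 / 2 <= m.

Let s_ge2 : 2 <= 2 * m + 1. Proof. by have := m_half; lra. Qed.

Let m_gt0 : 0 < m. Proof. by have := m_half; lra. Qed.

Let term_ge0 n : 0 <= 2 * n.+1%:R / (n.+1%:R ^+ 2 + r ^+ 2) `^ (m + 1).
Proof. by rewrite divr_ge0 ?powR_ge0. Qed.

Let bound_cvg : (series (fun n => 2 * (n.+1%:R `^ (2 * m + 1))^-1 : R) @ \oo -->
  2 * zeta (2 * m + 1))%classic.
Proof.
have -> : series (fun n => 2 * (n.+1%:R `^ (2 * m + 1))^-1 : R) =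
    (fun n => 2 * [series (k.+1%:R `^ (2 * m + 1))^-1 : R]_k n).
  by apply/funext => n; rewrite /series /= mulr_sumr.
by apply: cvgM; [exact: cvg_cst | exact: cvg_zeta_series].
Qed.

Let cvg_mathieu :
  cvgn (series (fun n => 2 * n.+1%:R / (n.+1%:R ^+ 2 + r ^+ 2) `^ (m + 1))).
Proof.
apply: series_le_cvg (cvgP _ bound_cvg) => // n; exact: mathieu_term_le.
Qed.

Lemma mathieu_ge0 : 0 <= mathieu m r.
Proof.
by apply: limr_ge => //; apply: nearW => n; rewrite /series /= sumr_ge0.
Qed.

Lemma mathieu_le_zeta : mathieu m r <= 2 * zeta (2 * m + 1).
Proof.
have <- := cvg_lim (@Rhausdorff R) bound_cvg.
apply: (lim_series_le cvg_mathieu (cvgP _ bound_cvg)) => n.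
exact: mathieu_term_le.
Qed.

End mathieu_bounds.

(** * Tonelli's theorem on a rectangle *)

(** Extending k by zero outside D x E turns both iterated integrals into integrals over the whole
    plane. *)
Lemma fubini_tonelli_rect {R : realType} (D E : set R) (k : R * R -> R) :
  measurable D -> measurable E -> measurable_fun setT k -> (forall p, 0 <= k p) ->
  (\int[leb]_(x in D) \int[leb]_(y in E) (k (x, y))%:E =
   \int[leb]_(y in E) \int[leb]_(x in D) (k (x, y))%:E)%E.
Proof.
move=> mD mE mk k0; pose kDE := ((EFin \o k) \_ (D `*` E))%classic.
rewrite integral_mkcond [RHS]integral_mkcond.
transitivity (\int[leb]_x \int[leb]_y kDE (x, y))%E.
  apply: eq_integral => x _; rewrite patchE; case: ifPn => xD.
    rewrite integral_mkcond; apply: eq_integral => y _.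
    by rewrite /kDE !patchE in_setX /= xD.
  by rewrite integral0_eq// => y _; rewrite /kDE patchE in_setX /= (negbTE xD).
rewrite fubini_tonelli; last 2 first.
- apply/(measurable_restrictT (EFin \o k)); first exact: measurableX.
  by apply: measurable_funTS; apply/measurable_EFinP.
- by move=> p; apply: erestrict_ge0 => q _; rewrite lee_fin.
apply: eq_integral => y _; rewrite patchE; case: ifPn => yE.
  rewrite [RHS]integral_mkcond; apply: eq_integral => x _.
  by rewrite /kDE !patchE in_setX /= yE andbT.
by rewrite integral0_eq// => x _; rewrite /kDE patchE in_setX /= (negbTE yE) andbF.
Qed.

(** * The recurrence of Gamma as an inequality *)

Section Gamma_functional.
Context {R : realType}.
Implicit Types a : R.

(** Integration by parts of t^a against -e^(-t) on compact intervals. The boundary term at the right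
    end is nonpositive and is dropped; the one at the left end x is at most x^a. *)
Lemma Gamma_succ_le a : 1 < a -> Gamma (a + 1) <= a * Gamma a.
Proof.
move=> a1; have a0 : 0 < a by lra.
rewrite -lee_fin EFinM !EFin_Gamma ?addrK; [|lra..].
set C := (a%:E * _)%E.
have dP (x : R) : 0 < x -> is_derive x 1 (@powR R ^~ a) (a * x `^ (a - 1)).
  exact: is_derive1_powR.
have dE (x : R) : is_derive x 1 (fun t : R => - expR (- t)) (expR (- x)).
  by apply: is_derive_eq; rewrite /GRing.scale/=; ring.
have cP b (x : R) : 0 < x -> {for x, continuous (@powR R ^~ b)}.
  exact: continuous_powR_pos.
have cE (x : R) : {for x, continuous (fun t : R => - expR (- t))}.
  apply/differentiable_continuous/derivable1_diffP.
  by apply: ex_derive; exact: dE.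
have cE' (x : R) : {for x, continuous (fun t : R => expR (- t))}.
  by apply: continuous_comp; [exact: continuousN|exact: continuous_expR].
have parts (x y : R) : 0 < x -> x < y ->
    (\int[leb]_(t in `[x, y]) (t `^ a * expR (- t))%:E <= C + (x `^ a)%:E)%E.
  move=> x0 xy; have y0 := lt_trans x0 xy.
  rewrite (@integration_by_parts R (@powR R ^~ a) (fun t => - expR (- t))
    (fun t => a * t `^ (a - 1)) (fun t => expR (- t)) x y)//.
  - rewrite addeC; apply: leeD; last first.
      rewrite lee_fin; have := mulr_ge0 (powR_ge0 y a) (expR_ge0 (- y)).
      have : x `^ a * expR (- x) <= x `^ a.
        by rewrite ler_piMr ?powR_ge0// -[leRHS]expR0 ler_expR; lra.
      by lra.
    under eq_integral do rewrite mulrN EFinN -mulrA EFinM.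
    rewrite integral_ge0N; last first.
      by move=> t _; rewrite -EFinM lee_fin mulr_ge0 ?(ltW a0) ?Gamma_integrand_ge0.
    rewrite oppeK ge0_integralZl_EFin ?(ltW a0)//; last 2 first.
    + by move=> t _; rewrite lee_fin Gamma_integrand_ge0.
    + by apply/measurable_EFinP; exact: measurable_Gamma_integrand.
    rewrite /C lee_wpmul2l ?lee_fin ?(ltW a0)//; apply: ge0_subset_integral => //.
    + by apply/measurable_EFinP; exact: measurable_Gamma_integrand.
    + by move=> t _; rewrite lee_fin Gamma_integrand_ge0.
    + by move=> t; rewrite /= !in_itv /= andbT => /andP[xt _]; exact: lt_le_trans xt.
  - apply: continuous_in_subspaceT => t; rewrite inE /= in_itv /= => /andP[xt _].
    by apply: cvgM; [exact: cvg_cst|apply: cP; exact: lt_le_trans xt].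
  - split.
    + move=> t; rewrite in_itv /= => /andP[xt _].
      by apply: ex_derive; apply: dP; exact: lt_trans xt.
    + by apply: cvg_at_right_filter; exact: cP.
    + by apply: cvg_at_left_filter; exact: cP.
  - move=> t; rewrite in_itv /= => /andP[xt _].
    by rewrite derive1E; have [_ ->] := dP _ (lt_trans x0 xt).
  - by apply: continuous_in_subspaceT => t _; exact: cE'.
  - split.
    + by move=> t _; apply: ex_derive; exact: dE.
    + by apply: cvg_at_right_filter; exact: cE.
    + by apply: cvg_at_left_filter; exact: cE.
  - by move=> t _; rewrite derive1E; have [_ ->] := dE t.
apply: ge0_integral_oy_le.
- exact: measurable_Gamma_integrand.
- by move=> x _; rewrite mulr_ge0 ?powR_ge0 ?expR_ge0.
(* The boundary term [z `^ a] vanishes as the left end [z] tends to 0. *)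
move=> x y x0 xy; apply/lee_addgt0Pr => e e0.
pose z := Num.min x (e `^ a^-1).
have z0 : 0 < z by rewrite lt_min x0 powR_gt0.
have zx : z <= x by rewrite ge_min lexx.
apply: (@le_trans _ _ (C + (z `^ a)%:E)%E); last first.
  rewrite leeD2l// lee_fin.
  rewrite [leRHS](_ : _ = (e `^ a^-1) `^ a); last first.
    by rewrite -powRrM mulVf ?powRr1 ?(ltW e0)// gt_eqF.
  by rewrite ge0_ler_powR ?nnegrE ?powR_ge0 ?(ltW a0) ?(ltW z0)// ge_min lexx orbT.
apply: le_trans (parts _ _ z0 (le_lt_trans zx xy)).
apply: ge0_subset_integral => //.
- by apply/measurable_EFinP; exact: measurable_Gamma_integrand.
- by move=> t _; rewrite lee_fin mulr_ge0 ?powR_ge0 ?expR_ge0.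
- by apply: subset_itvr; rewrite bnd_simp.
Qed.

End Gamma_functional.

(** * The duplication formula as an inequality *)

(** Provides the measurability needed to compare outer integrals of iterated ones, again through
    extension by zero. *)
Lemma measurable_integral_section {R : realType} (E : set R) (k : R * R -> R) :
  measurable E -> measurable_fun setT k -> (forall p, 0 <= k p) ->
  measurable_fun setT (fun x => \int[leb]_(y in E) (k (x, y))%:E)%E.
Proof.
move=> mE mk k0; pose kE := ((EFin \o k) \_ (setT `*` E))%classic.
have -> : (fun x => \int[leb]_(y in E) (k (x, y))%:E)%E = fubini_F leb kE.
  apply/funext => x; rewrite integral_mkcond; apply: eq_integral => y _.
  by rewrite /kE !patchE in_setX /= in_setT.
apply: measurable_fun_fubini_tonelli_F.
- apply/(measurable_restrictT (EFin \o k)); first exact: measurableX.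
  by apply: measurable_funTS; apply/measurable_EFinP.
- by move=> p; apply: erestrict_ge0 => q _; rewrite lee_fin.
Qed.

Section half_duplication.
Context {R : realType}.
Variable a : R.

(* The integrand of [Gamma (a + 1/2) * Gamma a] in the variables [(s, v)],
   [v = sqrt (s t)]. *)
Let kernel (p : R * R) : R :=
  2 * p.2 `^ (2 * a - 1) *
  (p.1 `^ (- (1 / 2)) * expR (- p.1) * expR (- (p.2 ^+ 2 * p.1 `^ (-1)))).

Let kernel_ge0 p : 0 <= kernel p.
Proof. by rewrite /kernel !mulr_ge0 ?powR_ge0 ?expR_ge0. Qed.

Let measurable_kernel : measurable_fun setT kernel.
Proof.
have m1 := @measurable_fst _ _ R R; have m2 := @measurable_snd _ _ R R.
have mpow c (h : R * R -> R) : measurable_fun setT h -> measurable_fun setT (fun p => h p `^ c).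
  by move=> mh; exact: (measurableT_comp (@measurable_powR R c) mh).
have mexp (h : R * R -> R) : measurable_fun setT h -> measurable_fun setT (fun p => expR (- h p)).
  move=> mh; apply: (measurableT_comp (@measurable_expR R)).
  exact: (measurableT_comp (@oppr_measurable R setT) mh).
apply: measurable_funM; first by apply: measurable_funM => //; exact: mpow.
apply: measurable_funM.
  by apply: measurable_funM; [exact: mpow | exact: mexp].
apply: mexp; apply: measurable_funM; last exact: mpow.
exact: measurable_funX.
Qed.

Let kernel_cvg (s v : R) : 0 < v -> {for v, continuous (fun v => kernel (s, v))}.
Proof.
move=> v0; rewrite /kernel /=; apply: cvgM.
  by apply: cvgM; [exact: cvg_cst | exact: continuous_powR_pos].
apply: cvgM; first exact: cvg_cst.
apply: continuous_comp; last exact: continuous_expR.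
by apply: continuousN; apply: cvgM; [exact: exprn_continuous | exact: cvg_cst].
Qed.

(** With s fixed, v = sqrt(s t) has v^2 / s = t, and [kernel] times dv/dt is exactly the product of
    the two Gamma integrands. *)
Let integral_kernel_ge (s : R) : 0 < s ->
  (\int[leb]_(t in `]0%R, +oo[)
     ((s `^ (a + 1 / 2 - 1) * expR (- s)) * (t `^ (a - 1) * expR (- t)))%:E <=
   \int[leb]_(v in `]0%R, +oo[) (kernel (s, v))%:E)%E.
Proof.
move=> s0; pose F t := s `^ (1 / 2) * t `^ (1 / 2).
pose f t := s `^ (1 / 2) * (1 / 2 * t `^ (1 / 2 - 1)).
have fE (t : R) : 0 < t ->
    (s `^ (a + 1 / 2 - 1) * expR (- s)) * (t `^ (a - 1) * expR (- t)) =
    kernel (s, F t) * f t.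
  (* Writing s and t as exponentials of their logarithms reduces the identity to a linear one
     between exponents. *)
  move=> t0; rewrite /F /f /kernel /= -[s]lnK// -[t]lnK//.
  set p := ln s; set q := ln t.
  rewrite -!expRM -!expRD -!expRM -expRM_natl -!expRD.
  rewrite (_ : 2 * (p * (1 / 2) + q * (1 / 2)) + p * -1 = q); last by field.
  have halve (A B C D : R) : 2 * A * B * (C * (1 / 2 * D)) = A * B * C * D by field.
  by rewrite halve -!expRD; congr expR; field.
under eq_integral => t.
  rewrite inE /= in_itv /= andbT => t0; rewrite (fE _ t0); over.
apply: (@ge0_substitution_oy_le R F f (fun v => kernel (s, v))).
- move=> t t0; have := @is_derive1_powR R (1 / 2) t t0; rewrite -/(F t) => dpow.
  by apply: is_derive_eq; rewrite /f /GRing.scale/=; ring.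
- by move=> t t0; rewrite /f !mulr_gt0 ?powR_gt0//; lra.
- move=> t t0; apply: cvgM; first exact: cvg_cst.
  by apply: cvgM; [exact: cvg_cst | exact: continuous_powR_pos].
- exact: interval_open.
- exact: interval_is_interval.
- by move=> t t0; rewrite /= in_itv /= andbT mulr_gt0 ?powR_gt0.
- by move=> v; rewrite /= in_itv /= andbT; exact: kernel_cvg.
- by move=> v _; exact: kernel_ge0.
Qed.

Let integral_kernel_le (v : R) : 0 < v ->
  (\int[leb]_(s in `]0%R, +oo[) (kernel (s, v))%:E <=
   (4 * v `^ (2 * a - 1) * expR (- (2 * v)) * Num.sqrt pi)%:E)%E.
Proof.
(* The 4 is the factor 2 in [kernel] times the 2 in s^(-1/2) <= 2 F'(s); sqrt(pi) will come from the
   Gaussian integral over the line. *)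
move=> v0; set c := _ * expR (- (2 * v)).
have c0 : 0 <= c by rewrite /c !mulr_ge0 ?powR_ge0 ?expR_ge0.
pose F s := s `^ (1 / 2) - v * s `^ (- (1 / 2)).
pose f s := 1 / 2 * s `^ (1 / 2 - 1) + v * (1 / 2 * s `^ (- (1 / 2) - 1)).
have f_gt0 (s : R) : 0 < s -> 0 < f s.
  by move=> s0; rewrite /f addr_gt0 ?mulr_gt0 ?powR_gt0//; lra.
have cf (s : R) : 0 < s -> {for s, continuous f}.
  move=> s0; apply: cvgD.
    by apply: cvgM; [exact: cvg_cst | exact: continuous_powR_pos].
  apply: cvgM; first exact: cvg_cst.
  by apply: cvgM; [exact: cvg_cst | exact: continuous_powR_pos].
have dF (s : R) : 0 < s -> is_derive s 1 F (f s).
  move=> s0; have d1 := @is_derive1_powR R (1 / 2) s s0.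
  have d2 := @is_derive1_powR R (- (1 / 2)) s s0.
  by apply: is_derive_eq; rewrite /f /GRing.scale/=; ring.
(* [s + v^2 / s = 2 v + F(s)^2], and [s^(-1/2) <= 2 F'(s)]; dropping the other
   half of [F'] is what loses the factor 2 of Legendre's formula. *)
have kernel_le (s : R) : 0 < s -> kernel (s, v) <= c * (gauss_fun (F s) * f s).
  move=> s0; rewrite /kernel /=.
  have E : expR (- s) * expR (- (v ^+ 2 * s `^ (-1))) =
      expR (- (2 * v)) * gauss_fun (F s).
    rewrite /gauss_fun -!expRD; congr expR; rewrite /F -[s]lnK// -!expRM.
    (* In terms of q = sqrt s, the identity of exponents is rational: q^2 + v^2 / q^2 = 2 v + (q - v
       / q)^2. *)
    set q := expR (ln s * (1 / 2)).
    have -> : ln s * - (1 / 2) = - (ln s * (1 / 2)) by ring.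
    have -> : expR (ln s * -1) = q ^- 2.
      by rewrite mulrN1 expRN -expRM_natl; congr (expR _)^-1; field.
    have -> : expR (ln s) = q ^+ 2 by rewrite -expRM_natl; congr expR; field.
    have q0 : q != 0 by rewrite gt_eqF ?expR_gt0.
    by rewrite expRN -/q; field.
  have pow_le : s `^ (- (1 / 2)) <= 2 * f s.
    rewrite /f (_ : 1 / 2 - 1 = - (1 / 2)); last by field.
    have := mulr_ge0 (ltW v0) (powR_ge0 s (- (1 / 2) - 1)); lra.
  rewrite -(mulrA (s `^ _)) E /c.
  set V := v `^ _; set e := expR _; set g := gauss_fun _.
  rewrite (_ : 2 * V * _ = 2 * V * e * g * s `^ (- (1 / 2))); last by ring.
  rewrite (_ : 4 * V * e * _ = 2 * V * e * g * (2 * f s)); last by ring.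
  by rewrite ler_wpM2l// !mulr_ge0 ?powR_ge0 ?expR_ge0.
have mgF : measurable_fun (`]0%R, +oo[%classic : set R) (fun s : R => gauss_fun (F s) * f s).
  apply: open_continuous_measurable_fun => // s; rewrite inE /= in_itv /= andbT => s0.
  apply: cvgM; last exact: cf.
  apply: continuous_comp; last exact: continuous_gauss_fun.
  apply/differentiable_continuous/derivable1_diffP.
  by apply: ex_derive; exact: dF.
apply: (@le_trans _ _ (c%:E * \int[leb]_(s in `]0%R, +oo[) (gauss_fun (F s) * f s)%:E)%E).
  rewrite -ge0_integralZl_EFin//; last 2 first.
  - move=> s; rewrite /= in_itv /= andbT => s0.
    by rewrite lee_fin mulr_ge0 ?gauss_fun_ge0// ltW// f_gt0.
  - exact/measurable_EFinP.
  apply: ge0_le_integral => //.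
  - by move=> s _; rewrite lee_fin.
  - apply/measurable_EFinP; apply: measurable_funTS.
    exact: (measurable_fun_pair1 v measurable_kernel).
  - by apply/(@measurable_EFinP _ _ _ _ (fun s => c * (gauss_fun (F s) * f s))); exact: measurable_funM.
  - by move=> s; rewrite /= in_itv /= andbT -EFinM lee_fin; exact: kernel_le.
rewrite [leRHS]EFinM lee_wpmul2l ?lee_fin// -integralT_gauss.
apply: ge0_substitution_oy_le => //.
- exact: openT.
- move=> y _; exact: continuous_gauss_fun.
- move=> y _; exact: gauss_fun_ge0.
Qed.

Lemma Gamma_duplication_half_le : 1 < a ->
  Gamma a * Gamma (a + 1 / 2) <=
  4 * Num.sqrt pi / 2 `^ (2 * a) * Gamma (2 * a).
Proof.
move=> a1; set c : R := 4 * _ / _.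
have c0 : 0 <= c by rewrite /c divr_ge0 ?powR_ge0// mulr_ge0 ?sqrtr_ge0.
have Ga0 : 0 <= Gamma a by rewrite ltW// Gamma_gt0.
have G1 := @EFin_Gamma R (a + 1 / 2) ltac:(lra).
have G2 := @EFin_Gamma R (2 * a) ltac:(lra).
rewrite -lee_fin [leLHS]EFinM [leRHS]EFinM.
rewrite [X in (_ * X <= _)%E]G1 [X in (_ <= _ * X)%E]G2.
rewrite -ge0_integralZl_EFin//; last 2 first.
- by move=> t _; rewrite lee_fin Gamma_integrand_ge0.
- by apply/measurable_EFinP; exact: measurable_Gamma_integrand.
(* For each s, the constant [Gamma a] is opened as the inner t-integral and then bounded by the
   v-integral of [kernel]. *)
apply: (@le_trans _ _ (\int[leb]_(s in `]0%R, +oo[)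
    \int[leb]_(v in `]0%R, +oo[) (kernel (s, v))%:E)%E).
  apply: ge0_le_integral => //.
  - by move=> s _; rewrite -EFinM lee_fin mulr_ge0// Gamma_integrand_ge0.
  - apply/(@measurable_EFinP _ _ _ _ (fun s => Gamma a * (s `^ (a + 1 / 2 - 1) * expR (- s)))).
    by apply: measurable_funM => //; exact: measurable_Gamma_integrand.
  - by apply: measurable_funTS; exact: (@measurable_integral_section R _ kernel).
  - move=> s; rewrite /= in_itv /= andbT => s0.
    apply: le_trans _ (integral_kernel_ge _ s0).
    under [leRHS]eq_integral do rewrite EFinM.
    rewrite ge0_integralZl_EFin ?Gamma_integrand_ge0//.
    + by rewrite -EFin_Gamma// muleC.
    + by move=> t _; rewrite lee_fin Gamma_integrand_ge0.
    + by apply/measurable_EFinP; exact: measurable_Gamma_integrand.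
rewrite fubini_tonelli_rect//.
(* The integrand of Gamma(2a) pulled back along t = 2 v, the last 2 being dt/dv. The bound of
   [integral_kernel_le] is exactly [c * f v]. *)
pose f (v : R) := (2 * v) `^ (2 * a - 1) * expR (- (2 * v)) * 2.
have f_ge0 v : 0 <= f v by rewrite /f mulr_ge0// Gamma_integrand_ge0.
have mf : measurable_fun (`]0%R, +oo[%classic : set R) f.
  apply: measurable_funTS; apply: measurable_funM => //.
  apply: (measurableT_comp (measurable_Gamma_integrand (2 * a - 1) setT)).
  exact: measurable_funM.
apply: (@le_trans _ _ (\int[leb]_(v in `]0%R, +oo[) (c%:E * (f v)%:E))%E).
  have mswap : measurable_fun setT (fun p : R * R => kernel (p.2, p.1)).
    exact: (measurableT_comp measurable_kernel (@measurable_swap _ _ R R)).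
  apply: ge0_le_integral => //.
  - by move=> v _; apply: integral_ge0 => s _; rewrite lee_fin.
  - apply: measurable_funTS.
  exact: (@measurable_integral_section R `]0%R, +oo[%classic (fun p => kernel (p.2, p.1)) (measurable_itv _) mswap (fun=> kernel_ge0 _)).
  - by apply/(@measurable_EFinP _ _ _ _ (fun v => c * f v)); exact: measurable_funM.
  - move=> v; rewrite /= in_itv /= andbT => v0.
    apply: le_trans (integral_kernel_le _ v0) _.
    have two_pow : 2 `^ (2 * a) = 2 * 2 `^ (2 * a - 1) :> R.
      by rewrite mulr_powRB1//; lra.
    have := powR_gt0 (2 * a - 1) (ltr0Sn R 1) => /gt_eqF two_pow_neq0.
    rewrite -EFinM lee_fin /c /f powRM ?(ltW v0)// two_pow.
    by rewrite le_eqVlt; apply/orP; left; apply/eqP; field; rewrite two_pow_neq0.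
rewrite ge0_integralZl_EFin//; last 2 first.
- by move=> v _; rewrite lee_fin.
- exact/measurable_EFinP.
rewrite lee_wpmul2l// /f.
apply: (@ge0_substitution_oy_le R (fun v => 2 * v) (cst 2)
  (fun t => t `^ (2 * a - 1) * expR (- t))) => //.
- by move=> v _; apply: is_derive_eq; rewrite /GRing.scale/=; ring.
- by move=> v _; exact: cst_continuous.
- exact: interval_is_interval.
- by move=> v v0; rewrite /= in_itv /= andbT mulr_gt0.
- move=> t; rewrite /= in_itv /= andbT => t0.
  apply: cvgM; first exact: continuous_powR_pos.
  by apply: continuous_comp; [exact: continuousN | exact: continuous_expR].
- by move=> t _; exact: Gamma_integrand_ge0.
Qed.

End half_duplication.

(** * Assembly: the subtracted term dominates the first one *)

Theorem theorem2 (R : realType) (mu : R) (hmu : 3 / 2 < mu)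
    (r : R) (hr : 0 < r) :
  mathieu mu r >=
    (2 * mu - 1) / (2 * mu * r ^+ 3) * mathieu (mu - 1) r
    - (2 * mu - 1) * Num.sqrt pi * Gamma (2 * mu) * zeta (2 * mu - 1)
      / (2 `^ (2 * mu - 2) * r ^+ 3 * Gamma (mu + 1) * Gamma (mu + 1 / 2)).
Proof.
have [mu1 mu_sub mu_half mu_dbl mu_succ] :
    [/\ 1 < mu, 1 / 2 <= mu - 1, 1 < mu + 1 / 2, 1 < 2 * mu & 1 < mu + 1].
  by split; lra.
have mu0 : 0 < mu by apply: lt_trans mu1.
have dbl_pred : 0 <= 2 * mu - 1 by rewrite subr_ge0 ltW.
set c := _ / _; set d := _ / _.
have S1_ge0 : 0 <= mathieu mu r by apply: mathieu_ge0; lra.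
apply: le_trans S1_ge0; rewrite subr_le0.
have S0_le := mathieu_le_zeta (mu - 1) r mu_sub.
have S0_ge0 := mathieu_ge0 (mu - 1) r mu_sub.
rewrite (_ : 2 * (mu - 1) + 1 = 2 * mu - 1) in S0_le; last by ring.
set z := zeta _ in S0_le d *; set S0 := mathieu _ r in S0_le S0_ge0 *.
(* From 0 <= S_(mu-1)(r) <= 2 z. *)
have z0 : 0 <= z by lra.
have dup := Gamma_duplication_half_le mu mu1.
have succ := Gamma_succ_le mu mu1.
have G1 := Gamma_gt0 (mu + 1) mu_succ.
have Gh := Gamma_gt0 (mu + 1 / 2) mu_half.
rewrite /c /d.
set g1 := Gamma (mu + 1) in succ G1 *; set gh := Gamma (mu + 1 / 2) in dup Gh *.
set g2 := Gamma (2 * mu) in dup *; set g := Gamma mu in dup succ.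
set q := Num.sqrt pi in dup *.
have r3 : 0 < r ^+ 3 by rewrite exprn_gt0.
(* Aligns the power of 2 with the one in [dup]. *)
have -> : 2 `^ (2 * mu - 2) = 2 `^ (2 * mu) / 4 :> R.
  by rewrite powRB ?pnatr_eq0 ?implybT// (_ : 2 `^ 2 = 4)// powR_mulrn// -natrX.
set w := 2 `^ (2 * mu) in dup *.
have w0 : 0 < w by rewrite powR_gt0.
clear c d; clearbody z S0 g1 gh g2 g q w.
(* [succ] replaces Gamma(mu + 1) by mu Gamma(mu), then [dup] bounds Gamma(mu) Gamma(mu + 1/2). In
   quotient form: 1 / mu <= 4 q g2 / (w g1 gh). *)
have key : w * g1 * gh <= 4 * mu * q * g2.
  have h1 : w * (g * gh) <= 4 * q * g2.
    move: dup; rewrite -(ler_pM2l w0) => /le_trans; apply.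
    by rewrite le_eqVlt; apply/orP; left; apply/eqP; field; rewrite gt_eqF.
  apply: (@le_trans _ _ (mu * (w * (g * gh)))); last first.
    by rewrite (_ : 4 * mu * q * g2 = mu * (4 * q * g2)) ?ler_pM2l//; ring.
  rewrite (_ : mu * _ = w * (mu * g) * gh); last by ring.
  by rewrite ler_pM2r// ler_pM2l.
(* The middle value is the first term with S_(mu-1)(r) replaced by 2 z. The subtracted term has the
   same shape, with 1 / mu replaced by the quotient that [key] controls. *)
apply: (@le_trans _ _ ((2 * mu - 1) * z / r ^+ 3 * mu^-1)).
  rewrite (_ : _ * mu^-1 = (2 * mu - 1) / (2 * mu * r ^+ 3) * (2 * z)).
    by rewrite ler_wpM2l// divr_ge0// ltW// !mulr_gt0.
  by field; rewrite !gt_eqF.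
rewrite (_ : _ / (w / 4 * _ * _ * _) =
    (2 * mu - 1) * z / r ^+ 3 * (4 * q * g2 / (w * g1 * gh))); last first.
  by field; rewrite !gt_eqF.
rewrite ler_wpM2l//.
  by rewrite divr_ge0 ?(ltW r3)// mulr_ge0.
rewrite ler_pdivlMr ?mulr_gt0// ler_pdivrMl//.
by rewrite !mulrA (mulrC mu).
Qed.
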